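(* Min-VB-SM Probabilistic Lobbying (defined in the context) can be approximated in polynomial time within a factor of $\ln(N)+1$, where $N$ is the strict cover number of the given instance.
   Context: Probabilistic lobbying setting. There are $m$ voters $v_1,\dots,v_m$ and $n$ issues $r_1,\dots,r_n$. A probability matrix $P=(p_{i,j})\in(\mathbb{Q}\cap[0,1])^{m\times n}$ gives the probability that $v_i$ votes ''yes'' on $r_j$. A discretization level $k\in\mathbb{N}$ is chosen so that $k+1$ is a common multiple of the denominators of all $p_{i,j}$; admissible probability values are $0,\frac1{k+1},\dots,1$. For each $(i,j)$ a price function $c_{i,j}:\{0,\frac1{k+1},\dots,1\}\to\mathbb{N}$ with $c_{i,j}(p_{i,j})=0$, monotone in the sense that $p_{i,j}\le a\le b$ or $p_{i,j}\ge a\ge b$ implies $c_{i,j}(a)\le c_{i,j}(b)$, gives the price of changing $v_i$'s probability on $r_j$ to $a$; these form a cost matrix $C_P$. The Lobby has a target vector $\vec Z\in\{0,1\}^n$; a threshold $t\in\mathbb{Q}\cap[0,1]$ is given. Voter $v_i$ favors the agenda on $r_j$ if his probability of voting $Z_j$ ($p_{i,j}$ if $Z_j=1$, $1-p_{i,j}$ if $Z_j=0$) exceeds $t$. Strict majority (SM): $r_j$ is won iff strictly more than $m/2$ voters favor the agenda on it. Voter bribery: The Lobby chooses an amount $d_i\ge0$ per voter; $d_i$ is split equally among the $n$ issues, and for each $j$ the probability of $v_i$ on $r_j$ moves toward $Z_j$ to the farthest admissible value $a$ with $c_{i,j}(a)\le d_i/n$; its cost is $\sum_i d_i$. Min-VB-SM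 Probabilistic Lobbying: given $P,C_P,\vec Z$ (and $t$), find a voter bribery of minimum total cost making every issue won under SM. The strict cover number of issue $r_j$ is the number of additional voters who must be brought to favor the agenda on $r_j$ for a strict majority, i.e. $\max(0,\lfloor m/2\rfloor+1-f_j)$ where $f_j$ is the number of voters currently favoring the agenda on $r_j$; the strict cover number $N$ of the instance is the sum of these over all issues. *)

(* Defs.v *)
From HB Require Import structures.
From mathcomp Require Import all_boot all_order all_algebra.
From mathcomp Require Import all_classical all_reals all_analysis.

Set Implicit Arguments.
Unset Strict Implicit.
Unset Printing Implicit Defensive.

Import Order.TTheory GRing.Theory Num.Theory.

Local Open Scope ring_scope.

(******************************************************************************)
(* Polynomial time: a random access machine over natural numbers with         *)
(* structured control and finitely many named arrays per program, under the   *)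
(* logarithmic cost criterion of Cook-Reckhow and Aho-Hopcroft-Ullman. Every  *)
(* evaluated subexpression (in particular every address and every number read *)
(* or written) is charged the length of its value in binary, so that running  *)
(* times are polynomially related to those of Turing machines.                *)
(******************************************************************************)

Definition bitlen (x : nat) : nat := (trunc_log 2 x).+1.

Inductive expr : Type :=
| Const of nat
| Get of nat & expr   (* Get x e : cell e of array x *)
| Add of expr & expr
| Sub of expr & expr  (* truncated *)
| Mul of expr & expr.

Inductive cmd : Type :=
| Skip
| Assign of nat & expr & expr  (* Assign x e1 e2 : cell e1 of array x := e2 *)
| Seq of cmd & cmd
| If of expr & cmd & cmd     (* tests hold when nonzero *)
| While of expr & cmd.

Definition store : Type := nat -> nat -> nat.

Definition update (s : store) (x i v : nat) : store :=
  fun y j => if (y == x) && (j == i) then v else s y j.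

Fixpoint eval (s : store) (e : expr) : nat :=
  match e with
  | Const v => v
  | Get x e1 => s x (eval s e1)
  | Add e1 e2 => (eval s e1 + eval s e2)%N
  | Sub e1 e2 => (eval s e1 - eval s e2)%N
  | Mul e1 e2 => (eval s e1 * eval s e2)%N
  end.

Fixpoint ecost (s : store) (e : expr) : nat :=
  (bitlen (eval s e) +
   match e with
   | Const _ => 0
   | Get _ e1 => ecost s e1
   | Add e1 e2 | Sub e1 e2 | Mul e1 e2 => ecost s e1 + ecost s e2
   end)%N.

(* exec c s T s' : started in s, c halts in s' after time T *)
Inductive exec : cmd -> store -> nat -> store -> Prop :=
| ExecSkip s : exec Skip s 1 s
| ExecAssign s x e1 e2 :
    exec (Assign x e1 e2) s (ecost s e1 + ecost s e2)
      (update s x (eval s e1) (eval s e2))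
| ExecSeq s s1 s2 c1 c2 T1 T2 :
    exec c1 s T1 s1 -> exec c2 s1 T2 s2 ->
    exec (Seq c1 c2) s (T1 + T2) s2
| ExecIfTrue s s1 e c1 c2 T :
    eval s e <> 0%N -> exec c1 s T s1 ->
    exec (If e c1 c2) s (ecost s e + T) s1
| ExecIfFalse s s1 e c1 c2 T :
    eval s e = 0%N -> exec c2 s T s1 ->
    exec (If e c1 c2) s (ecost s e + T) s1
| ExecWhileTrue s s1 s2 e c T1 T2 :
    eval s e <> 0%N -> exec c s T1 s1 -> exec (While e c) s1 T2 s2 ->
    exec (While e c) s (ecost s e + T1 + T2) s2
| ExecWhileFalse s e c :
    eval s e = 0%N -> exec (While e c) s (ecost s e) s.

(* The input is array 0; all other cells are initially 0. *)
Definition input_store (w : seq nat) : store :=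
  fun x i => if x == 0%N then nth 0%N w i else 0%N.

(* The output is an initial segment of array 1; this determines the encoded
   object because the encodings below are self-delimiting. *)
Definition outputs (s : store) (w : seq nat) : Prop :=
  forall i : nat, (i < size w)%N -> s 1%N i = nth 0%N w i.

Definition input_size (w : seq nat) : nat := (\sum_(x <- w) bitlen x)%N.

(* Lists are preceded by their length, so that a list of l items has size at
   least l whatever the items are (e.g. the rows of a matrix without columns). *)
Definition enc_list (T : Type) (enc : T -> seq nat) (l : seq T) : seq nat :=
  size l :: flatten (map enc l).

(* Only used for nonnegative rationals *)
Definition enc_rat (q : rat) : seq nat := [:: `|numq q|%N; `|denq q|%N].

(* The price functions live on {0, 1/(k+1), ..., 1}, indexed by 'I_k.+2. *)
Definition admissible (k : nat) (l : 'I_k.+2) : rat := l%:R / k.+1%:R.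

Record instance : Type := Instance {
  voters : nat;
  issues : nat;
  level : nat;
  prob : 'I_voters -> 'I_issues -> rat;
  price : 'I_voters -> 'I_issues -> 'I_level.+2 -> nat;
  target : 'I_issues -> bool;
  threshold : rat;
  threshold_itv : 0 <= threshold <= 1;
  prob_itv : forall i j, 0 <= prob i j <= 1;
  level_denq : forall i j, (denq (prob i j) %| level.+1%:Z)%Z;
  price_prob : forall i j l, admissible l = prob i j -> price i j l = 0%N;
  price_mono : forall i j a b,
    (prob i j <= admissible a <= admissible b) ||
    (admissible b <= admissible a <= prob i j) ->
    (price i j a <= price i j b)%N
}.

Definition enc_instance (I : instance) : seq nat :=
  level I :: enc_rat (threshold I)
  ++ enc_list (fun j => [:: nat_of_bool (target j)]) (enum 'I_(issues I))
  ++ enc_list (fun i =>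
       enc_list (fun j =>
           enc_rat (prob i j)
           ++ enc_list (fun l => [:: price i j l]) (enum 'I_(level I).+2))
         (enum 'I_(issues I)))
       (enum 'I_(voters I)).

Definition enc_amounts (m : nat) (d : 'I_m -> rat) : seq nat :=
  enc_list (fun i => enc_rat (d i)) (enum 'I_m).

Section Lobbying.
Variable I : instance.

Definition favors (j : 'I_(issues I)) (p : rat) : bool :=
  threshold I < (if target j then p else 1 - p).

Definition favor_count (Q : 'I_(voters I) -> 'I_(issues I) -> rat)
    (j : 'I_(issues I)) : nat :=
  #|[set i | favors j (Q i j)]|.

Definition won (Q : 'I_(voters I) -> 'I_(issues I) -> rat)
    (j : 'I_(issues I)) : bool :=
  (voters I)%:R / 2 < (favor_count Q j)%:R :> rat.

Definition strict_cover_number : nat :=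
  (\sum_(j < issues I) ((voters I)./2.+1 - favor_count (@prob I) j))%N.

Variable R : realType.
Implicit Type d : 'I_(voters I) -> R.

(* The default value of the maximum and minimum is itself admissible, at price
   0. *)
Definition bribed_prob d (i : 'I_(voters I)) (j : 'I_(issues I)) : rat :=
  let p := prob i j in
  let affordable l := (price i j l)%:R <= d i / (issues I)%:R in
  if target j
  then \big[Num.max/p]_(l | (p <= admissible l) && affordable l) admissible l
  else \big[Num.min/p]_(l | (admissible l <= p) && affordable l) admissible l.

Definition winning_bribery d : Prop :=
  (forall i, 0 <= d i) /\ (forall j, won (bribed_prob d) j).

Definition bribery_cost d : R := \sum_i d i.

Definition min_cost : R :=
  inf [set bribery_cost d | d in [set d | winning_bribery d]]%classic.

End Lobbying.

(* Main.v *)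
Require Import Defs.
From HB Require Import structures.
From mathcomp Require Import all_boot all_order all_algebra.
From mathcomp Require Import all_classical all_reals all_analysis.
From mathcomp Require Import zify ring.
(* Again, because MathComp shadows [Sub] and [eval]. *)
Import Defs.

Import Order.TTheory GRing.Theory Num.Theory.

(* Voter [i], paid [a] per issue, favors the agenda on issue [j] iff some
   admissible value of price at most [a] favors it; the direction of the move is
   irrelevant because the current probability is itself admissible at price 0.
   Only amounts [n * a] with [a] one of the prices matter, so voter bribery is a
   multicover problem in which every voter offers a chain of nested sets.

   The greedy algorithm raises one voter to one price, maximizing the ratio of
   the newly met demand to the increase of the amount. If [r] units of demand
   remain and a winning bribery costs [c], then raising every voter to the level
   of that bribery meets all of them, so some raise has ratio at least [r / c],
   and the chosen raise, meeting [g] units, costs at most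
   [c * (g / r) <= c * (phi r - phi (r - g))], where [phi 0 = 0] and
   [phi r = ln r + 1] otherwise. The sum telescopes to [c * phi N].

   On the machine, a greedy round evaluates two closed expressions built from
   arithmetic, comparison and sums over polynomially bounded ranges; all such
   expressions compile to programs of polynomial running time. *)

Local Open Scope nat_scope.

(** * Running times *)

Definition polyfun (f : nat -> nat) : Prop :=
  exists q : {poly nat}, forall x, f x = (q.[x])%R.

Lemma polyfun_const (c : nat) : polyfun (fun=> c).
Proof. by exists (c%:P)%R => x; rewrite hornerC. Qed.

Lemma polyfun_id : polyfun (fun x => x).
Proof. by exists 'X%R => x; rewrite hornerX. Qed.

Lemma polyfunD (f g : nat -> nat) :
  polyfun f -> polyfun g -> polyfun (fun x => f x + g x).
Proof.
by move=> [p fp] [q gq]; exists (p + q)%R => x; rewrite hornerD fp gq.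
Qed.

Lemma polyfunM (f g : nat -> nat) :
  polyfun f -> polyfun g -> polyfun (fun x => f x * g x).
Proof.
by move=> [p fp] [q gq]; exists (p * q)%R => x; rewrite hornerM fp gq.
Qed.

Ltac solve_polyfun :=
  repeat first [assumption | exact: polyfun_id | apply: polyfun_const
               | apply: polyfunD | apply: polyfunM].

Lemma bitlen_le (x y : nat) : x <= 2 ^ y -> bitlen x <= y.+1.
Proof.
move=> le_xy; rewrite /bitlen ltnS.
by apply: leq_trans (leq_trunc_log 2 le_xy) _; rewrite trunc_expnK.
Qed.

Lemma leq_pow2_bitlen (x : nat) : x <= 2 ^ bitlen x.
Proof. by rewrite ltnW // /bitlen trunc_log_ltn. Qed.

Fixpoint esize (e : expr) : nat :=
  match e with
  | Const v => v.+1
  | Get _ e1 => (esize e1).+1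
  | Add e1 e2 | Sub e1 e2 | Mul e1 e2 => (esize e1 + esize e2).+1
  end.

Fixpoint reads_le (s : store) (Y : nat) (e : expr) : Prop :=
  match e with
  | Const _ => True
  | Get x e1 => s x (eval s e1) <= 2 ^ Y /\ reads_le s Y e1
  | Add e1 e2 | Sub e1 e2 | Mul e1 e2 => reads_le s Y e1 /\ reads_le s Y e2
  end.

Lemma eval_le (s : store) (Y : nat) (e : expr) :
  0 < Y -> reads_le s Y e -> eval s e <= 2 ^ (Y * esize e).
Proof.
move=> Y0.
have mono a b : a <= b -> 2 ^ (Y * a) <= 2 ^ (Y * b).
  by move=> ab; rewrite leq_exp2l // leq_mul2l ab orbT.
elim: e => [v|x e IH|e1 IH1 e2 IH2|e1 IH1 e2 IH2|e1 IH1 e2 IH2] /=.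
- move=> _; apply: leq_trans (ltnW (ltn_expl v (ltnSn 1))) _.
  by rewrite leq_exp2l //; nia.
- move=> [le_s _]; apply: leq_trans le_s _.
  by rewrite leq_exp2l // -{1}[Y]muln1 leq_mul2l orbT.
- move=> [/IH1 h1 /IH2 h2].
  apply: (@leq_trans (2 ^ (Y * (esize e1 + esize e2)) * 2)); last first.
    by rewrite -expnSr leq_exp2l // mulnS -add1n leq_add2r.
  rewrite muln2 -addnn; apply: leq_add.
    by apply: leq_trans h1 _; apply: mono; rewrite leq_addr.
  by apply: leq_trans h2 _; apply: mono; rewrite leq_addl.
- move=> [/IH1 h1 _]; apply: leq_trans (leq_subr _ _) _.
  by apply: leq_trans h1 _; apply: mono; rewrite leqW // leq_addr.
- move=> [/IH1 h1 /IH2 h2]; apply: leq_trans (leq_mul h1 h2) _.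
  by rewrite -expnD -mulnDr; apply: mono.
Qed.

Lemma ecost_le (s : store) (Y : nat) (e : expr) :
  0 < Y -> reads_le s Y e -> ecost s e <= Y * (esize e).+1 ^ 2.
Proof.
move=> Y0 le_e.
have bl e' : reads_le s Y e' -> bitlen (eval s e') <= Y * (esize e').+1.
  move=> /(@eval_le s Y e' Y0)/bitlen_le h; apply: leq_trans h _.
  by rewrite mulnS -add1n leq_add2r.
elim: e le_e => [v|x e IH|e1 IH1 e2 IH2|e1 IH1 e2 IH2|e1 IH1 e2 IH2] le_e;
  have := bl _ le_e; rewrite /ecost -/ecost;
  move: (bitlen _) => b; rewrite /esize -/esize.
- nia.
- by case: le_e => _ /IH; nia.
- by case: le_e => /IH1 h1 /IH2 h2; nia.
- by case: le_e => /IH1 h1 /IH2 h2; nia.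
- by case: le_e => /IH1 h1 /IH2 h2; nia.
Qed.

Definition runs (c : cmd) (s : store) (B : nat) (Q : store -> Prop) : Prop :=
  exists T s', [/\ exec c s T s', T <= B & Q s'].

Lemma runs_weaken (c : cmd) (s : store) (B B' : nat) (Q Q' : store -> Prop) :
  B <= B' -> (forall s', Q s' -> Q' s') -> runs c s B Q -> runs c s B' Q'.
Proof.
move=> BB' QQ' [T [s' [ex TB /QQ' q]]]; exists T, s'; split=> //.
exact: leq_trans BB'.
Qed.

Lemma runs_seq (c1 c2 : cmd) (s : store) (B1 B2 : nat) (P Q : store -> Prop) :
  runs c1 s B1 P -> (forall s', P s' -> runs c2 s' B2 Q) ->
  runs (Seq c1 c2) s (B1 + B2) Q.
Proof.
move=> [T1 [s1 [ex1 TB1 /[swap] /[apply]]]] [T2 [s2 [ex2 TB2 q]]].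
by exists (T1 + T2), s2; split; [exact: ExecSeq ex1 ex2|exact: leq_add|].
Qed.

Definition assign_cost (Y : nat) (e1 e2 : expr) : nat :=
  Y * ((esize e1).+1 ^ 2 + (esize e2).+1 ^ 2).

Lemma runs_assign (x : nat) (e1 e2 : expr) (s : store) (Y : nat)
    (Q : store -> Prop) :
  0 < Y -> reads_le s Y e1 -> reads_le s Y e2 ->
  Q (update s x (eval s e1) (eval s e2)) ->
  runs (Assign x e1 e2) s (assign_cost Y e1 e2) Q.
Proof.
move=> Y0 r1 r2 q; exists (ecost s e1 + ecost s e2); eexists.
split; [exact: ExecAssign| |exact: q].
by rewrite /assign_cost mulnDr leq_add // ecost_le.
Qed.

Lemma runs_while (e : expr) (c : cmd) (D B N : nat) (Inv : nat -> store -> Prop)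
    (s : store) :
  (forall i s', i < N -> Inv i s' ->
     [/\ eval s' e <> 0, ecost s' e <= D & runs c s' B (Inv i.+1)]) ->
  (forall s', Inv N s' -> eval s' e = 0 /\ ecost s' e <= D) ->
  Inv 0 s -> runs (While e c) s (N * (D + B) + D) (Inv N).
Proof.
move=> step stop inv0.
suff gen k : forall i s', k + i = N -> Inv i s' ->
    runs (While e c) s' (k * (D + B) + D) (Inv N).
  by apply: gen inv0; rewrite addn0.
elim: k => [|k IH] i s' eN inv.
  move: inv; rewrite -eN add0n => inv; rewrite add0n in eN.
  have [|e0 eD] := stop s'; first by rewrite -eN.
  by exists (ecost s' e), s'; split=> //; exact: ExecWhileFalse.
have iN : i < N by lia.
have [e0 eD [T1 [s1 [ex1 TB1 inv1]]]] := step _ _ iN inv.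
have [|T2 [s2 [ex2 TB2 inv2]]] := IH i.+1 s1 _ inv1; first by lia.
exists (ecost s' e + T1 + T2), s2; split=> //.
  exact: ExecWhileTrue ex1 ex2.
by rewrite mulSn; lia.
Qed.

(** * Compiling arithmetic expressions with bounded sums *)

Inductive sexp : Type :=
| Lit of nat
| Cell of nat & sexp
| Plus of sexp & sexp
| Minus of sexp & sexp
| Times of sexp & sexp
| Leq of sexp & sexp
| Sum of nat & nat & sexp.

(* Array 2 holds the variables. Expressions only read even arrays, hence never
   the stack, which is array 3. *)
Fixpoint sem (s : store) (e : sexp) : nat :=
  match e with
  | Lit c => c
  | Cell x e1 => s x.*2 (sem s e1)
  | Plus e1 e2 => sem s e1 + sem s e2
  | Minus e1 e2 => sem s e1 - sem s e2
  | Times e1 e2 => sem s e1 * sem s e2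
  | Leq e1 e2 => (sem s e1 <= sem s e2)%N
  | Sum v w e1 => \sum_(i < s 2 w) sem (update s 2 v i) e1
  end.

Local Notation "c1 ;; c2" := (Seq c1 c2)
  (at level 65, right associativity, only parsing).

Local Notation stk r := (Get 3 (Const r)).

Definition apply_op (op : expr -> expr -> expr) (c1 c2 : cmd) (r : nat) : cmd :=
  c1 ;; c2 ;; Assign 3 (Const r) (op (stk r) (stk r.+1)).

(* The stack cells below [r] are left untouched. *)
Fixpoint comp (e : sexp) (r : nat) : cmd :=
  match e with
  | Lit c => Assign 3 (Const r) (Const c)
  | Cell x e1 => comp e1 r ;; Assign 3 (Const r) (Get x.*2 (stk r))
  | Plus e1 e2 => apply_op Add (comp e1 r) (comp e2 r.+1) r
  | Minus e1 e2 => apply_op Sub (comp e1 r) (comp e2 r.+1) r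
  | Times e1 e2 => apply_op Mul (comp e1 r) (comp e2 r.+1) r
  | Leq e1 e2 =>
      apply_op (fun a b => Sub (Const 1) (Sub a b)) (comp e1 r) (comp e2 r.+1) r
  | Sum v w e1 =>
      Assign 3 (Const r) (Const 0) ;;
      Assign 3 (Const r.+1) (Get 2 (Const v)) ;;
      Assign 3 (Const r.+2) (Get 2 (Const w)) ;;
      Assign 2 (Const v) (Const 0) ;;
      While (Sub (stk r.+2) (Get 2 (Const v)))
        (comp e1 r.+3 ;;
         Assign 3 (Const r) (Add (stk r) (stk r.+3)) ;;
         Assign 2 (Const v) (Add (Get 2 (Const v)) (Const 1))) ;;
      Assign 2 (Const v) (stk r.+1)
  end.

Definition agree (r : nat) (s s' : store) : Prop :=
  forall x i, (x != 3) || (i < r) -> s' x i = s x i.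

Definition bounded (S : nat) (s : store) : Prop :=
  (forall x i, x != 3 -> s x i <= 2 ^ S) /\ (forall i, s 2 i <= S).

Lemma agree_trans (r r' : nat) (s1 s2 s3 : store) :
  r <= r' -> agree r s1 s2 -> agree r' s2 s3 -> agree r s1 s3.
Proof.
move=> rr' a12 a23 x i h; rewrite a23 ?a12 //.
by case/orP: h => [->//|ir]; rewrite (leq_trans ir) ?orbT.
Qed.

Lemma agree_stack (r i v : nat) (s : store) :
  r <= i -> agree r s (update s 3 i v).
Proof.
move=> ri x j h; rewrite /update; case: andP => // -[/eqP ex /eqP ej].
by move: h; rewrite ex ej /= ltnNge ri.
Qed.

Lemma bounded_agree (S r : nat) (s s' : store) :
  agree r s s' -> bounded S s -> bounded S s'.
Proof.
move=> a [b1 b2]; split=> [x i h|i]; first by rewrite a ?b1 // h.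
by rewrite a.
Qed.

Lemma bounded_var (S v i : nat) (s : store) :
  i <= S -> bounded S s -> bounded S (update s 2 v i).
Proof.
move=> iS [b1 b2]; split=> [x j h|j]; rewrite /update; case: andP => // _.
- by apply: leq_trans iS _; rewrite ltnW // ltn_expl.
- exact: b1.
Qed.

Lemma sem_agree (s s' : store) (e : sexp) :
  (forall x i, x != 3 -> s' x i = s x i) -> sem s' e = sem s e.
Proof.
elim: e s s' => [c|x e IH|e1 IH1 e2 IH2|e1 IH1 e2 IH2|e1 IH1 e2 IH2
  |e1 IH1 e2 IH2|v w e IH] s s' a //=;
  rewrite ?(IH1 _ _ a) ?(IH2 _ _ a) //.
  by rewrite (IH _ _ a) a //; apply/eqP; lia.
rewrite a //; apply: eq_bigr => i _; apply: IH => x j h.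
by rewrite /update a.
Qed.

Fixpoint vsize (e : sexp) : nat :=
  match e with
  | Lit c => c.+1
  | Cell _ _ => 1
  | Plus e1 e2 => (vsize e1 + vsize e2).+1
  | Minus e1 _ => vsize e1
  | Times e1 e2 => vsize e1 + vsize e2
  | Leq _ _ => 1
  | Sum _ _ e1 => (vsize e1).+1
  end.

Lemma sem_le (S : nat) (s : store) (e : sexp) :
  0 < S -> bounded S s -> sem s e <= 2 ^ (S * vsize e).
Proof.
move=> S0.
have mono a b : a <= b -> 2 ^ (S * a) <= 2 ^ (S * b).
  by move=> ab; rewrite leq_exp2l // leq_mul2l ab orbT.
elim: e s => [c|x e IH|e1 IH1 e2 IH2|e1 IH1 e2 IH2|e1 IH1 e2 IH2
  |e1 IH1 e2 IH2|v w e IH] s b; rewrite [sem _ _]/= [vsize _]/=.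
- apply: leq_trans (ltnW (ltn_expl c (ltnSn 1))) _.
  by rewrite leq_exp2l //; nia.
- by rewrite muln1; apply: (proj1 b); apply/eqP; lia.
- apply: (@leq_trans (2 ^ (S * (vsize e1 + vsize e2)) * 2)); last first.
    by rewrite -expnSr leq_exp2l // mulnS -add1n leq_add2r.
  rewrite muln2 -addnn; apply: leq_add.
    by apply: leq_trans (IH1 _ b) _; apply: mono; rewrite leq_addr.
  by apply: leq_trans (IH2 _ b) _; apply: mono; rewrite leq_addl.
- exact: leq_trans (leq_subr _ _) (IH1 _ b).
- by rewrite mulnDr expnD; apply: leq_mul; [exact: IH1|exact: IH2].
- by apply: leq_trans (leq_b1 _) _; rewrite expn_gt0.
- rewrite mulnS expnD.
  apply: (@leq_trans (\sum_(i < s 2 w) 2 ^ (S * vsize e))).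
    apply: leq_sum => i _; apply: IH; apply: bounded_var (b).
    exact: leq_trans (ltnW (ltn_ord i)) (proj2 b w).
  rewrite sum_nat_const card_ord leq_mul2r; apply/orP; right.
  by apply: leq_trans (proj2 b w) _; rewrite ltnW // ltn_expl.
Qed.

Definition comp_spec (e : sexp) : Prop :=
  forall r, exists2 f, polyfun f & forall S s, 0 < S -> bounded S s ->
    runs (comp e r) s (f S) (fun s' => agree r s s' /\ s' 3 r = sem s e).

Lemma apply_op_runs (op : expr -> expr -> expr) (g : nat -> nat -> nat)
    (e1 e2 : sexp) (r : nat) :
  (forall s a b, eval s (op a b) = g (eval s a) (eval s b)) ->
  (forall s Y a b, reads_le s Y a -> reads_le s Y b -> reads_le s Y (op a b)) ->
  comp_spec e1 -> comp_spec e2 ->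
  exists2 f, polyfun f & forall S s, 0 < S -> bounded S s ->
    runs (apply_op op (comp e1 r) (comp e2 r.+1) r) s (f S)
      (fun s' => agree r s s' /\ s' 3 r = g (sem s e1) (sem s e2)).
Proof.
move=> op_eval op_reads /(_ r)[f1 pf1 run1] /(_ r.+1)[f2 pf2 run2].
exists (fun S => f1 S + (f2 S + assign_cost (S * (vsize e1 + vsize e2).+1)
   (Const r) (op (stk r) (stk r.+1)))).
  by rewrite /assign_cost; solve_polyfun.
move=> S s S0 b; apply: runs_seq (run1 _ _ S0 b) _ => s1 [a1 v1].
have b1 := bounded_agree _ _ _ _ a1 b.
apply: runs_seq (run2 _ _ S0 b1) _ => s2 [a2 v2].
have v2r : s2 3 r = sem s e1 by rewrite a2 // ltnSn orbT.
have v2r1 : s2 3 r.+1 = sem s e2.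
  by rewrite v2; apply: sem_agree => x i h; rewrite a1 ?h.
have le_pow x e : x <= 2 ^ (S * vsize e) -> vsize e <= vsize e1 + vsize e2 ->
    x <= 2 ^ (S * (vsize e1 + vsize e2).+1).
  move=> le_x le_e; apply: leq_trans le_x _.
  by rewrite leq_exp2l // leq_mul2l leqW ?orbT.
apply: runs_assign; first by rewrite muln_gt0 S0.
- by [].
- apply: op_reads; split=> //=.
    by rewrite v2r (le_pow _ e1) ?leq_addr ?sem_le.
  by rewrite v2r1 (le_pow _ e2) ?leq_addl ?sem_le.
split.
  apply: agree_trans (agree_stack _ _ _ _ (leqnn r)); first exact: leqnn.
  exact: agree_trans (leqnSn r) a1 a2.
by rewrite /update /= eqxx op_eval /= v2r v2r1.
Qed.

Lemma comp_runs (e : sexp) : comp_spec e.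
Proof.
elim: e => [c|x e IH|e1 IH1 e2 IH2|e1 IH1 e2 IH2|e1 IH1 e2 IH2
  |e1 IH1 e2 IH2|v w e IH] r.
- exists (fun S => assign_cost S (Const r) (Const c)).
    by rewrite /assign_cost; solve_polyfun.
  move=> S s S0 b; apply: runs_assign => //; split; first exact: agree_stack.
  by rewrite /update /= eqxx.
- have [f pf run] := IH r.
  exists (fun S => f S + assign_cost (S * (vsize e).+1) (Const r)
                            (Get x.*2 (stk r))).
    by rewrite /assign_cost; solve_polyfun.
  move=> S s S0 b; apply: runs_seq (run _ _ S0 b) _ => s1 [a1 v1] /=.
  have x3 : x.*2 != 3 by apply/eqP; lia.
  have le_pow y e' : y <= 2 ^ (S * e') -> e' <= (vsize e).+1 ->
      y <= 2 ^ (S * (vsize e).+1).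
    move=> le_y le_e; apply: leq_trans le_y _.
    by rewrite leq_exp2l // leq_mul2l le_e orbT.
  apply: runs_assign; first by rewrite muln_gt0 S0.
  + by [].
  + rewrite /= v1 a1 ?x3 //; split; last first.
      by split=> //; rewrite (le_pow _ (vsize e)) ?sem_le.
    by rewrite (le_pow _ 1) // muln1 (proj1 b).
  split; first by apply: agree_trans a1 (agree_stack _ _ _ _ (leqnn r)).
  by rewrite /update /= eqxx v1 a1 ?x3.
- by apply: (apply_op_runs Add addn) => //= ? ? ? ?; split.
- by apply: (apply_op_runs Sub subn) => //= ? ? ? ?; split.
- by apply: (apply_op_runs Mul muln) => //= ? ? ? ?; split.
- apply: (apply_op_runs _ (fun a b => (a <= b)%N : nat)) => //= s a b.
  by case: leqP => h; lia.
have [f pf run] := IH r.+3.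
pose K := (vsize e).+1.
exists (fun S =>
  assign_cost S (Const r) (Const 0) +
  (assign_cost S (Const r.+1) (Get 2 (Const v)) +
  (assign_cost S (Const r.+2) (Get 2 (Const w)) +
  (assign_cost S (Const v) (Const 0) +
  (S * (S * (esize (Sub (stk r.+2) (Get 2 (Const v)))).+1 ^ 2 +
     (f S + (assign_cost (S * K) (Const r) (Add (stk r) (stk r.+3)) +
       assign_cost S (Const v) (Add (Get 2 (Const v)) (Const 1))))) +
   S * (esize (Sub (stk r.+2) (Get 2 (Const v)))).+1 ^ 2 +
  assign_cost S (Const v) (stk r.+1)))))).
  by rewrite /assign_cost; solve_polyfun.
move=> S s S0 b; rewrite [comp _ _]/=.
have ltS2 x : x <= S -> x <= 2 ^ S.
  by move=> /leq_trans->//; rewrite ltnW // ltn_expl.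
have bv := proj2 b v; have bw := proj2 b w.
apply: runs_seq (runs_assign _ _ _ _ S
  (fun s' => agree r s s' /\ s' 3 r = 0) S0 _ _ _) _ => //.
  by split; [exact: agree_stack|rewrite /update /= eqxx].
move=> s1 [a1 v1].
apply: runs_seq (runs_assign _ _ _ _ S
  (fun s' => [/\ agree r s s', s' 3 r = 0 & s' 3 r.+1 = s 2 v])
  S0 _ _ _) _ => //.
- by split=> //=; rewrite a1 // ltS2.
- split; first by apply: agree_trans a1 (agree_stack _ _ _ _ _).
    by rewrite /update /= ltn_eqF.
  by rewrite /update /= eqxx a1.
move=> s2 [a2 v2 v2'].
apply: runs_seq (runs_assign _ _ _ _ S
  (fun s' => [/\ agree r s s', s' 3 r = 0, s' 3 r.+1 = s 2 v &
     s' 3 r.+2 = s 2 w]) S0 _ _ _) _ => //.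
- by split=> //=; rewrite a2 // ltS2.
- split; first by apply: agree_trans a2 (agree_stack _ _ _ _ _).
  + by rewrite /update /= ltn_eqF.
  + by rewrite /update /= ltn_eqF.
  + by rewrite /update /= eqxx a2.
move=> s3 [a3 v3 v3' v3''].
pose Inv i s' := [/\ agree r (update s 2 v i) s',
  s' 3 r = \sum_(k < i) sem (update s 2 v k) e,
  s' 3 r.+1 = s 2 v & s' 3 r.+2 = s 2 w].
apply: runs_seq (runs_assign _ _ _ _ S (Inv 0) S0 _ _ _) _ => //.
  split; rewrite /update //= ?big_ord0 //.
  by move=> x i h; case: andP => // _; exact: a3.
move=> s4 inv4.
have var_v i s' : Inv i s' -> s' 2 v = i.
  by move=> [a _ _ _]; rewrite a // /update !eqxx.
apply: (runs_seq _ _ _ _ _ (Inv (s 2 w))); last first.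
  move=> s5 inv5; have [a5 w5 w5' w5''] := inv5.
  apply: (runs_assign _ _ _ _ S) => //=; first by rewrite w5' ltS2.
  split; last by rewrite /update /= w5.
  move=> x i h; rewrite /update w5'; case: andP => [[/eqP-> /eqP->]//|nv].
  by rewrite a5 // /update; case: andP.
have test_reads i s' : i <= s 2 w -> Inv i s' ->
    reads_le s' S (Sub (stk r.+2) (Get 2 (Const v))).
  move=> iw inv; have [_ _ _ w''] := inv.
  by rewrite /= (var_v _ _ inv) w'' !ltS2 // (leq_trans iw).
apply: (runs_weaken _ _ _ _ (Inv (s 2 w))); last first.
  apply: runs_while inv4.
- move=> i s' iw inv; have iS : i <= S by apply: leq_trans (ltnW iw) bw.
  have [a w0 w' w''] := inv.
  split; first by rewrite /= w'' (var_v _ _ inv); lia.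
    by apply: (ecost_le _ S) => //; apply: test_reads inv; exact: ltnW.
  have bi := bounded_var S v i s iS b; have bs' := bounded_agree _ _ _ _ a bi.
  apply: runs_seq (run _ _ S0 bs') _ => s5 [a5 v5].
  have v5' : s5 3 r.+3 = sem (update s 2 v i) e.
    by rewrite v5; apply: sem_agree => x j h; rewrite a ?h.
  have s5r : s5 3 r = \sum_(k < i) sem (update s 2 v k) e.
    by rewrite a5 // ltnW ?orbT // ltnW.
  have sum_le : \sum_(k < i) sem (update s 2 v k) e <= 2 ^ (S * K).
    apply: (@leq_trans (\sum_(k < i) 2 ^ (S * vsize e))).
      apply: leq_sum => k _; apply: sem_le => //; apply: bounded_var b.
      exact: leq_trans (ltnW (ltn_ord k)) iS.
    rewrite sum_nat_const card_ord /K mulnS expnD leq_mul2r.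
    by rewrite ltS2 ?orbT.
  apply: runs_seq (runs_assign _ _ _ _ (S * K) (fun s' =>
      [/\ agree r (update s 2 v i) s',
        s' 3 r = \sum_(k < i.+1) sem (update s 2 v k) e,
        s' 3 r.+1 = s 2 v & s' 3 r.+2 = s 2 w]) _ _ _ _) _ => //.
  + by rewrite muln_gt0 S0.
  + split; split=> //=; first by rewrite s5r.
    rewrite v5' (leq_trans (sem_le S _ _ _ bi)) //.
    by rewrite leq_exp2l // leq_mul2l leqnSn orbT.
  + split.
    * apply: agree_trans (agree_stack _ _ _ _ (leqnn r)) => //.
      by apply: agree_trans a a5; lia.
    * by rewrite /update /= eqxx big_ord_recr /= s5r v5'.
    * by rewrite /update /= gtn_eqF // a5 // ltnS leqnSn orbT.
    * by rewrite /update /= gtn_eqF ?a5 // ltnS leqnn orbT.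
  move=> s6 [a6 v6 v6' v6''].
  have s6v : s6 2 v = i by rewrite a6 // /update !eqxx.
  apply: (runs_assign _ _ _ _ S) => //=.
    by rewrite s6v ltS2.
  split; rewrite /update //=.
  move=> x j h; rewrite s6v addn1; case: andP => // nv.
  by rewrite a6 // /update; case: andP.
- move=> s' inv; split.
    by have [_ _ _ w''] := inv; rewrite /= (var_v _ _ inv) w'' subnn.
  by apply: (ecost_le _ S) => //; apply: test_reads inv.
- by [].
- by rewrite leq_add2r leq_mul2r bw orbT.
Qed.

(** * The greedy multicover algorithm *)

Section Greedy.

Variables (m n W : nat) (fav : nat -> nat -> nat -> bool) (cand : nat -> nat).

Definition cov (A : nat -> nat) (j : nat) : nat :=
  \sum_(i < m) fav i j (A i).

Definition gain (A : nat -> nat) (i a : nat) : nat :=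
  \sum_(j < n) (2 * cov A j <= m)%N * (fav i j a * (fav i j (A i) <= 0)%N).

Definition best (A : nat -> nat) (i p : nat) : nat :=
  (1 <= gain A i (cand p))%N *
  (\sum_(i' < m) \sum_(p' < W)
     (1 + gain A i (cand p) * (cand p' - A i')
        <= gain A i' (cand p') * (cand p - A i))%N <= 0)%N.

(* The least index below [N] where [P] is nonzero, and [N] if there is none: the
   number of indices up to which [P] vanishes. *)
Definition first (N : nat) (P : nat -> nat) : nat :=
  \sum_(x < N) (\sum_(y < N) (y <= x)%N * P y <= 0)%N.

Definition pick_voter (A : nat -> nat) : nat :=
  first m (fun i => \sum_(p < W) best A i p).

Definition pick_cand (A : nat -> nat) (i : nat) : nat := first W (best A i).

Definition greedy_step (A : nat -> nat) : nat -> nat :=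
  fun i => if i == pick_voter A then cand (pick_cand A (pick_voter A)) else A i.

Definition rem (A : nat -> nat) : nat := \sum_(j < n) (m./2.+1 - cov A j).

Lemma firstP (N : nat) (P : nat -> nat) :
  (first N P < N /\ P (first N P) != 0) \/
  (first N P = N /\ forall x, x < N -> P x = 0).
Proof.
have allz x : (\sum_(y < N) (y <= x)%N * P y <= 0)%N =
    [forall y : 'I_N, (y <= x) ==> (P y == 0)].
  rewrite leqn0 sum_nat_eq0; apply: eq_forallb => y /=.
  by rewrite muln_eq0 eqb0 implybE.
have [/existsP[x0 Px0]|/existsPn none] :=
    boolP [exists x : 'I_N, P x != 0]; last first.
  right; have z x : x < N -> P x = 0.
    by move=> xN; have := none (Ordinal xN); rewrite negbK => /eqP.
  split=> //; rewrite /first; under eq_bigr => x _.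
    have -> : (\sum_(y < N) (y <= x)%N * P y <= 0)%N = true.
      by rewrite allz; apply/forallP => y; rewrite z ?eqxx ?implybT.
    over.
  by rewrite sum_nat_const card_ord muln1.
left; have ex : exists x, (x < N) && (P x != 0).
  by exists x0; rewrite ltn_ord.
have [x /andP[xN Px] xmin] := ex_minnP ex.
suff -> : first N P = x by [].
rewrite /first (eq_bigr (fun y : 'I_N => ((y < x) : nat))); last first.
  move=> y _; rewrite allz; congr nat_of_bool.
  apply/forallP/idP => [all_z|yx z].
    rewrite ltnNge; apply/negP => xy; have := all_z (Ordinal xN).
    by rewrite /= xy (negPf Px).
  apply/implyP => zy; apply: contraLR yx => Pz.
  by rewrite -leqNgt (leq_trans _ zy) // xmin // ltn_ord.
rewrite -big_mkcond -(big_ord_widen _ (fun=> 1) (ltnW xN)).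
by rewrite sum1_card card_ord.
Qed.

Lemma first_le (N : nat) (P : nat -> nat) : first N P <= N.
Proof. by case: (firstP N P) => [[/ltnW]|[->]]. Qed.

Hypothesis fav_mono : forall i j a b, a <= b -> fav i j a -> fav i j b.

Lemma gain_gt0 (A : nat -> nat) (i a : nat) : 0 < gain A i a -> A i < a.
Proof.
apply: contraTT; rewrite -!leqNgt leqn0 => aA.
rewrite /gain big1 // => j _; case fa: (fav i j a); rewrite ?mul0n ?muln0 //.
by rewrite (fav_mono _ _ _ _ aA fa) muln0.
Qed.

Lemma bestP (A : nat -> nat) (i p : nat) :
  reflect (0 < gain A i (cand p) /\
      forall i' p', i' < m -> p' < W ->
        gain A i' (cand p') * (cand p - A i) <=
        gain A i (cand p) * (cand p' - A i'))
    (best A i p != 0).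
Proof.
rewrite muln_eq0 !eqb0 negb_or !negbK leqn0 sum_nat_eq0.
apply: (iffP andP) => -[g0 opt]; split=> //.
  move=> i' p' i'm p'W; have := forallP opt (Ordinal i'm).
  rewrite /= sum_nat_eq0 => /forallP/(_ (Ordinal p'W)) /=.
  by rewrite eqb0 -ltnNge add1n ltnS.
apply/forallP => i' /=; rewrite sum_nat_eq0; apply/forallP => p' /=.
by rewrite eqb0 -ltnNge add1n ltnS opt.
Qed.

Lemma best_exists (A : nat -> nat) (i0 p0 : nat) :
  i0 < m -> p0 < W -> 0 < gain A i0 (cand p0) ->
  exists i p, [/\ i < m, p < W & best A i p != 0].
Proof.
move=> i0m p0W g0.
pose g (c : 'I_m * 'I_W) := gain A c.1 (cand c.2).
pose w (c : 'I_m * 'I_W) := cand c.2 - A c.1.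
pose c0 := (Ordinal i0m, Ordinal p0W).
pose ratio c : rat := ((g c)%:R / (w c)%:R)%R.
have [c gc cmax] := @Order.TotalTheory.arg_maxP _ _ _ c0
  (fun c => 0 < g c) ratio g0.
exists c.1, c.2; split; rewrite ?ltn_ord //; apply/bestP; split=> // i p im pW.
have [g'0|/[dup] g'0] := posnP (gain A i (cand p)); first by rewrite g'0.
have := cmax (Ordinal im, Ordinal pW) => /[apply]; rewrite /ratio /g /w /=.
have w0 := gain_gt0 _ _ _ gc; have w'0 := gain_gt0 _ _ _ g'0.
rewrite ler_pdivrMr ?ltr0n ?subn_gt0 // mulrAC ler_pdivlMr ?ltr0n ?subn_gt0 //.
by rewrite -!natrM ler_nat.
Qed.

Lemma rem_step (A A' : nat -> nat) (i a : nat) :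
  i < m -> A i <= a -> A' i = a ->
  (forall k, k < m -> k != i -> A' k = A k) ->
  rem A = rem A' + gain A i a.
Proof.
move=> im Aa A'i A'k; rewrite -big_split /=; apply: eq_bigr => j _.
have -> : cov A' j = cov A j + fav i j a * (fav i j (A i) <= 0)%N.
  rewrite /cov (bigD1 (Ordinal im)) //= [in RHS](bigD1 (Ordinal im)) //= A'i.
  rewrite addnAC; congr (_ + _).
    by case fA: (fav i j (A i)); rewrite ?muln1 // (fav_mono _ _ _ _ Aa fA).
  by apply: eq_bigr => k ki; rewrite A'k.
move: (cov A j) => c; case: (fav i j a); case: (fav i j (A i)) => /=; lia.
Qed.

Lemma rem_le_gain (A B : nat -> nat) :
  (forall j, j < n -> m./2 < cov B j) -> rem A <= \sum_(i < m) gain A i (B i).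
Proof.
move=> winB; rewrite exchange_big /=; apply: leq_sum => j _.
rewrite -big_distrr /=.
set d := \sum_(i < m) _.
have : cov B j <= cov A j + d.
  rewrite /cov /d -big_split /=; apply: leq_sum => i _.
  by case: (fav i j (B i)); case: (fav i j (A i)).
have := winB j (ltn_ord j); move: (cov A j) (cov B j) d => cA cB d.
by case: leqP => h /=; lia.
Qed.

Hypothesis cand_cofinal : forall i a, i < m -> exists p,
  [/\ p < W, cand p <= a & forall j, j < n -> fav i j a -> fav i j (cand p)].

Lemma gain_cand (A : nat -> nat) (i a : nat) : i < m ->
  exists p, [/\ p < W, cand p <= a & gain A i a <= gain A i (cand p)].
Proof.
move=> /(cand_cofinal _ a)[p [pW pa favp]]; exists p; split=> //.
apply: leq_sum => j _; rewrite leq_mul2l; apply/orP; right.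
rewrite leq_mul2r; apply/orP; right.
by case fa: (fav i j a) => //; rewrite (favp j).
Qed.

Lemma best_ratio (A B : nat -> nat) (i p : nat) :
  (forall j, j < n -> m./2 < cov B j) -> best A i p != 0 ->
  (cand p - A i) * rem A <= gain A i (cand p) * \sum_(k < m) B k.
Proof.
move=> winB /bestP[_ opt].
apply: leq_trans (leq_mul (leqnn _) (rem_le_gain A _ winB)) _.
rewrite !big_distrr /=; apply: leq_sum => k _.
have [q [qW qB le_g]] := gain_cand A _ (B k) (ltn_ord k).
rewrite mulnC; apply: leq_trans (leq_mul le_g (leqnn _)) _.
apply: leq_trans (opt _ _ (ltn_ord k) qW) _.
by rewrite leq_mul2l (leq_trans (leq_subr _ _) qB) orbT.
Qed.

Lemma greedy_stepP (A B : nat -> nat) :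
  (forall j, j < n -> m./2 < cov B j) ->
  let A' := greedy_step A in
  (rem A = 0 /\ forall i, i < m -> A' i = A i) \/
  exists g w, [/\ 0 < g, rem A = rem A' + g,
    \sum_(i < m) A' i = \sum_(i < m) A i + w &
    w * rem A <= g * \sum_(i < m) B i].
Proof.
move=> winB A'.
have [[]|[none allz]] := firstP m (fun i => \sum_(p < W) best A i p);
  rewrite -/(pick_voter A); last first.
  have {}none : pick_voter A = m := none.
  left; split; last by move=> i im; rewrite /A' /greedy_step none ltn_eqF.
  apply/eqP; rewrite -leqn0; apply: leq_trans (rem_le_gain A _ winB) _.
  rewrite leqn0 sum_nat_eq0; apply/forallP => i /=; rewrite -leqn0 leqNgt.
  apply/negP => gi; have [p [pW _ le_g]] := gain_cand A _ (B i) (ltn_ord i).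
  have [|k [q [km qW bkq]]] := best_exists A i p (ltn_ord i) pW.
    exact: leq_trans le_g.
  move: bkq; have /eqP := allz k km; rewrite sum_nat_eq0.
  by move=> /forallP/(_ (Ordinal qW)) /= ->.
set i := pick_voter A => im.
rewrite sum_nat_eq0 => /forallPn[q /= bq].
have [[]|[_ allz]] := firstP W (best A i); last first.
  by move: bq; rewrite allz ?ltn_ord.
rewrite -/(pick_cand A i); set p := pick_cand A i => pW bp.
have [g0 _] := bestP _ _ _ bp; have w0 := gain_gt0 _ _ _ g0.
have A'i : A' i = cand p by rewrite /A' /greedy_step eqxx.
have A'k k : k != i -> A' k = A k by rewrite /A' /greedy_step => /negPf->.
right; exists (gain A i (cand p)), (cand p - A i); split=> //.
- by apply: rem_step => //; [exact: ltnW|move=> k _; exact: A'k].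
- rewrite (bigD1 (Ordinal im)) //= [in RHS](bigD1 (Ordinal im)) //= A'i.
  rewrite addnAC subnKC 1?ltnW //; congr (_ + _).
  by apply: eq_bigr => k ki; rewrite A'k.
- exact: best_ratio.
Qed.

Lemma rem_le (A B : nat -> nat) :
  (forall j, j < n -> m./2 < cov B j) -> rem A <= n * m.
Proof.
move=> winB; rewrite -[X in X * m]card_ord -sum_nat_const.
apply: leq_sum => j _.
apply: leq_trans (leq_subr _ _) (leq_trans (winB j (ltn_ord j)) _).
rewrite /cov -[X in _ <= X]card_ord -sum1_card; apply: leq_sum => i _.
exact: leq_b1.
Qed.

Lemma rem0_win (A : nat -> nat) (j : nat) :
  rem A = 0 -> j < n -> m./2 < cov A j.
Proof.
move=> /eqP; rewrite sum_nat_eq0 => /forallP /= all0 jn.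
by have := all0 (Ordinal jn); rewrite subn_eq0.
Qed.

Section Potential.
Variable R : realType.
Local Open Scope ring_scope.

Definition potential (r : nat) : R := if r == 0 then 0 else ln r%:R + 1.

Lemma potential_step (r g : nat) : (0 < g)%N ->
  g%:R / (r + g)%:R <= potential (r + g) - potential r.
Proof.
move=> g0; rewrite /potential addn_eq0 (gtn_eqF g0) andbF.
have [->|r0] := posnP r.
  rewrite add0n subr0 divff ?pnatr_eq0 ?gtn_eqF //.
  by rewrite lerDr ln_ge0 // ler1n.
rewrite opprD addrACA subrr addr0.
have R0 : (0 : R) < r%:R by rewrite ltr0n.
have RG0 : (0 : R) < (r + g)%:R by rewrite ltr0n addn_gt0 r0.
rewrite -lerN2 opprB -ln_div ?posrE //.
have -> : r%:R / (r + g)%:R = 1 + - (g%:R / (r + g)%:R) :> R.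
  by move: RG0; rewrite natrD => RG0; field; exact: lt0r_neq0.
apply: le_ln1Dx; rewrite ltrN2 ltr_pdivrMr // mul1r ltr_nat.
by rewrite -[X in (X < _)%N]add0n ltn_add2r.
Qed.

Lemma potential_le (r N : nat) : (r <= N)%N -> potential r <= ln N%:R + 1.
Proof.
move=> rN; rewrite /potential; have [r0|r0] := posnP r.
  have [->|N0] := posnP N; first by rewrite ln0 ?add0r.
  by rewrite addr_ge0 // ln_ge0 // ler1n.
by rewrite lerD2r ler_ln ?posrE ?ltr0n ?ler_nat // (leq_trans r0).
Qed.

Lemma greedy_cost (B : nat -> nat) (t : nat) :
  (forall j, (j < n)%N -> (m./2 < cov B j)%N) ->
  let A0 := fun=> 0%N in let A := iter t greedy_step A0 in
  ((rem A + t <= rem A0)%N \/ rem A = 0%N) /\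
  (\sum_(i < m) A i)%:R <=
    (\sum_(i < m) B i)%:R * (potential (rem A0) - potential (rem A)).
Proof.
move=> winB A0; elim: t => [|t /= [IHr IHc]] /=.
  by rewrite addn0 subrr mulr0 big1 //; split=> //; left.
set A := iter t _ _ in IHr IHc *.
have [[r0 same]|[g [w [g0 er ec le_w]]]] := greedy_stepP A B winB.
  have covA' j : cov (greedy_step A) j = cov A j.
    by apply: eq_bigr => i _; rewrite same.
  have -> : rem (greedy_step A) = rem A.
    by apply: eq_bigr => j _; rewrite covA'.
  split; first by right.
  by rewrite (eq_bigr (fun i : 'I_m => A i)) // => i _; rewrite same.
split.
  move: IHr er g0; move: (rem (greedy_step A)) (rem A) (rem A0) => x y z.
  by move=> [le_r|r0] er g0; [left|right]; lia.
rewrite ec natrD.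
have stepc : w%:R <= (\sum_(i < m) B i)%:R *
    (potential (rem A) - potential (rem (greedy_step A))) :> R.
  apply: le_trans (ler_wpM2l (ler0n _ _) _); last first.
    by rewrite er; exact: potential_step.
  rewrite -er mulrA ler_pdivlMr ?ltr0n; last by rewrite er; lia.
  by rewrite -!natrM ler_nat [X in (_ <= X)%N]mulnC.
apply: le_trans (lerD IHc stepc) _.
by rewrite -mulrDr addrA subrK.
Qed.

End Potential.
End Greedy.

(** * Reading an instance from its encoding *)

Lemma nth_blocks (T : Type) (b : nat) (f : T -> seq nat) (x0 : T) (s : seq T)
    (t : seq nat) (i r : nat) :
  (forall x, size (f x) = b) -> i < size s -> r < b ->
  nth 0 (flatten (map f s) ++ t) (i * b + r) = nth 0 (f (nth x0 s i)) r.
Proof.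
move=> sz + rb; elim: s i => [|x s IH] [|i] //= iS.
  by rewrite -catA nth_cat sz mul0n add0n rb.
by rewrite -catA nth_cat sz mulSn -addnA ltnNge leq_addr /= addKn IH.
Qed.

Lemma size_blocks (T : Type) (b : nat) (f : T -> seq nat) (s : seq T) :
  (forall x, size (f x) = b) -> size (flatten (map f s)) = size s * b.
Proof.
by move=> sz; elim: s => [|x s IH] //=; rewrite size_cat sz IH mulSn.
Qed.

Lemma nth_ord_blocks (N b : nat) (f : 'I_N -> seq nat) (t : seq nat) (i : 'I_N)
    (r : nat) :
  (forall x, size (f x) = b) -> r < b ->
  nth 0 (flatten (map f (enum 'I_N)) ++ t) (i * b + r) = nth 0 (f i) r.
Proof.
move=> sz rb; rewrite (nth_blocks _ _ _ i) ?size_enum_ord //.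
by rewrite nth_ord_enum.
Qed.

Lemma size_ord_blocks (N b : nat) (f : 'I_N -> seq nat) :
  (forall x, size (f x) = b) -> size (flatten (map f (enum 'I_N))) = N * b.
Proof. by move=> sz; rewrite (size_blocks _ _ _ _ sz) size_enum_ord. Qed.

Definition price_at (inp : nat -> nat) (n K i j l : nat) : nat :=
  inp (5 + n + (i * (1 + n * (3 + K)) + (1 + (j * (3 + K) + (3 + l))))).

Definition agenda_at (inp : nat -> nat) (j l : nat) : nat :=
  inp (4 + j) * (1 + inp 1 * (1 + inp 0) <= l * inp 2)%N +
  (1 - inp (4 + j)) * (1 + inp 1 * (1 + inp 0) <= (1 + inp 0 - l) * inp 2)%N.

Definition fav_at (inp : nat -> nat) (n K i j a : nat) : bool :=
  1 <= \sum_(l < K) (price_at inp n K i j l <= a)%N * agenda_at inp j l.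

Definition input (I : instance) (i : nat) : nat := nth 0 (enc_instance I) i.

(* This is the length of the first price list, and 0 when there is none. *)
Definition price_count (I : instance) : nat := input I (8 + issues I).

Section Encoding.
Variable I : instance.
Local Notation m := (voters I).
Local Notation n := (issues I).
Local Notation k := (level I).
Local Notation inp := (input I).

Definition enc_entry (i : 'I_m) (j : 'I_n) : seq nat :=
  enc_rat (prob i j) ++ enc_list (fun l => [:: price i j l]) (enum 'I_k.+2).

Definition enc_voter (i : 'I_m) : seq nat :=
  enc_list (enc_entry i) (enum 'I_n).

Lemma enc_instanceE : enc_instance I =
  [:: k; `|numq (threshold I)|; `|denq (threshold I)|; n] ++
  (flatten (map (fun j => [:: nat_of_bool (target j)]) (enum 'I_n)) ++
  (m :: flatten (map enc_voter (enum 'I_m)) ++ [::])).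
Proof.
transitivity ([:: k; `|numq (threshold I)|; `|denq (threshold I)|;
    size (enum 'I_n)] ++
  (flatten (map (fun j => [:: nat_of_bool (target j)]) (enum 'I_n)) ++
  (size (enum 'I_m) :: flatten (map enc_voter (enum 'I_m))))) => //.
by rewrite !size_enum_ord cats0.
Qed.

Lemma size_enc_entry (i : 'I_m) (j : 'I_n) : size (enc_entry i j) = 3 + k.+2.
Proof.
by rewrite /enc_entry size_cat /= (size_ord_blocks _ 1) // muln1.
Qed.

Lemma size_enc_voter (i : 'I_m) : size (enc_voter i) = 1 + n * (3 + k.+2).
Proof. by rewrite /= (size_ord_blocks _ _ _ (size_enc_entry i)). Qed.

Lemma size_enc_instance :
  size (enc_instance I) = 5 + n + m * (1 + n * (3 + k.+2)).
Proof.
rewrite enc_instanceE cats0 !size_cat /= (size_ord_blocks _ 1) // muln1.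
by rewrite (size_ord_blocks _ _ _ size_enc_voter); lia.
Qed.

Lemma input_issues : inp 3 = n.
Proof. by rewrite /input enc_instanceE. Qed.

Lemma input_target (j : 'I_n) : inp (4 + j) = target j.
Proof.
rewrite /input enc_instanceE nth_cat /= addKn -[val j]muln1 -[_ * 1]addn0.
by rewrite (nth_ord_blocks _ 1).
Qed.

Lemma input_tail (r : nat) : inp (4 + n + r) =
  nth 0 (m :: flatten (map enc_voter (enum 'I_m)) ++ [::]) r.
Proof.
rewrite /input enc_instanceE -addnA nth_cat /= addKn.
by rewrite nth_cat (size_ord_blocks _ 1) // muln1 ltnNge leq_addr /= addKn.
Qed.

Lemma input_voters : inp (4 + n) = m.
Proof. by rewrite -[4 + n]addn0 input_tail. Qed.

Lemma input_entry (i : 'I_m) (j : 'I_n) (r : nat) : r < 3 + k.+2 ->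
  inp (5 + n + (i * (1 + n * (3 + k.+2)) + (1 + (j * (3 + k.+2) + r)))) =
  nth 0 (enc_entry i j) r.
Proof.
move=> rk; rewrite -[5 + n]/((4 + n).+1) addSnnS input_tail /=.
have lt_r : 1 + (j * (3 + k.+2) + r) < 1 + n * (3 + k.+2).
  rewrite ltn_add2l; apply: (@leq_trans (j.+1 * (3 + k.+2))).
    by rewrite mulSn addnC ltn_add2r.
  by rewrite leq_mul2r ltn_ord orbT.
rewrite (nth_ord_blocks _ _ _ _ _ _ size_enc_voter lt_r) /= -[flatten _]cats0.
by rewrite (nth_ord_blocks _ _ _ _ _ _ (size_enc_entry i) rk).
Qed.

Lemma price_countE : price_count I = if (0 < m) && (0 < n) then k.+2 else 0.
Proof.
rewrite /price_count; case: ifPn => [/andP[m0 n0]|].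
  have := input_entry (Ordinal m0) (Ordinal n0) 2 isT; rewrite !mul0n /=.
  rewrite !add0n => e; rewrite -[RHS](size_enum_ord k.+2) -[RHS]e.
  by congr inp; lia.
have -> : 8 + n = 4 + n + 4 by lia.
rewrite input_tail negb_and -!leqNgt !leqn0.
case/orP => /eqP m0; last first.
  have -> : map enc_voter (enum 'I_m) = map (fun=> [:: 0]) (enum 'I_m).
    apply: eq_map => i; rewrite /enc_voter /enc_list.
    by rewrite (size0nil (s := enum 'I_n)) ?size_enum_ord.
  have -> : flatten (map (fun=> [:: 0]) (enum 'I_m)) = nseq m 0.
    rewrite -[X in nseq X](size_enum_ord m).
    by elim: (enum 'I_m) => //= a s ->.
  by rewrite cats0 /= nth_nseq if_same.
by rewrite (size0nil (s := enum 'I_m)) ?size_enum_ord.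
Qed.

Lemma size_input : size (enc_instance I) =
  5 + n + m * (1 + n * (3 + price_count I)).
Proof.
rewrite size_enc_instance price_countE.
by case: posnP => [->//|_]; case: posnP => [->|_]; rewrite ?mul0n ?muln0.
Qed.

Lemma price_atE (i : 'I_m) (j : 'I_n) (l : 'I_k.+2) :
  price_at inp n k.+2 i j l = price i j l.
Proof.
rewrite /price_at input_entry ?ltn_add2l // /enc_entry nth_cat /=.
rewrite -[nat_of_ord l]muln1 -[_ * 1]addn0 -[flatten _]cats0.
by rewrite (nth_ord_blocks _ 1).
Qed.

Lemma lt_threshold (c : nat) :
  (threshold I < c%:R / k.+1%:R)%R = (1 + inp 1 * (1 + inp 0) <= c * inp 2).
Proof.
have -> : inp 0 = k by rewrite /input enc_instanceE.
have -> : inp 1 = `|numq (threshold I)| by rewrite /input enc_instanceE.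
have -> : inp 2 = `|denq (threshold I)| by rewrite /input enc_instanceE.
have /andP[t0 _] := threshold_itv I.
have num0 : (`|numq (threshold I)|%:Z = numq (threshold I))%R.
  by rewrite gez0_abs // numq_ge0.
have den0 : (`|denq (threshold I)|%:Z = denq (threshold I))%R.
  by rewrite gtz0_abs ?denq_gt0.
have pos_den : (0 < `|denq (threshold I)|%:R :> rat)%R.
  by rewrite ltr0n absz_gt0 denq_neq0.
rewrite -{1}[threshold I]divq_num_den -num0 -den0 -!pmulrn.
rewrite ltr_pdivrMr // mulrAC ltr_pdivlMr ?ltr0n // -!natrM ltr_nat.
by rewrite !add1n.
Qed.

Lemma agenda_atE (j : 'I_n) (l : 'I_k.+2) :
  agenda_at inp j l = favors j (admissible l).
Proof.
rewrite /agenda_at /favors input_target /admissible.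
have -> : (1 - l%:R / k.+1%:R = (k.+1 - l)%:R / k.+1%:R :> rat)%R.
  rewrite natrB; last by rewrite -ltnS ltn_ord.
  by rewrite mulrBl divff // pnatr_eq0.
have e0 : inp 0 = k by rewrite /input enc_instanceE.
by case: (target j); rewrite lt_threshold e0 ?mul1n ?mul0n ?addn0 ?add0n.
Qed.

Definition fav : nat -> nat -> nat -> bool := fav_at inp n (price_count I).

Lemma favE (i : 'I_m) (j : 'I_n) (a : nat) :
  fav i j a = [exists l, (price i j l <= a) && favors j (admissible l)].
Proof.
rewrite /fav /fav_at price_countE (leq_ltn_trans (leq0n _) (ltn_ord i)).
rewrite (leq_ltn_trans (leq0n _) (ltn_ord j)) /= lt0n sum_nat_eq0.
rewrite -[RHS]negbK negb_exists; congr negb; apply: eq_forallb => l.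
by rewrite price_atE agenda_atE mulnb eqb0.
Qed.

Lemma fav_mono (i j a b : nat) : a <= b -> fav i j a -> fav i j b.
Proof.
move=> ab; rewrite /fav /fav_at => /leq_trans-> //; apply: leq_sum => l _.
rewrite leq_mul2r; apply/orP; right.
by case pa: (price_at _ _ _ _ _ _ <= a) => //; rewrite (leq_trans pa ab).
Qed.

Lemma exists_prob (i : 'I_m) (j : 'I_n) :
  exists l : 'I_k.+2, admissible l = prob i j.
Proof.
have /dvdzP[q kq] := level_denq i j; have /andP[p0 p1] := prob_itv i j.
have k0 : (k.+1%:R != 0 :> rat)%R by rewrite pnatr_eq0.
have ep : (prob i j * k.+1%:R = (q * numq (prob i j))%:~R)%R.
  rewrite -[(k.+1%:R)%R]/(k.+1%:Z%:~R)%R kq -{1}[prob i j]divq_num_den !intrM.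
  by rewrite mulrCA divfK // intr_eq0 denq_neq0.
have [l el] : exists l : nat, (q * numq (prob i j) = l%:Z)%R.
  exists `|(q * numq (prob i j))%R|; rewrite gez0_abs //.
  by rewrite -(ler_int rat) -ep mulr_ge0.
have lk : l < k.+2.
  rewrite ltnS -(ler_nat rat) -[(l%:R)%R]/(l%:Z%:~R)%R -el -ep.
  by rewrite ler_piMl.
exists (Ordinal lk); rewrite /admissible /=.
by apply: (mulIf k0); rewrite divfK // ep el.
Qed.

Lemma fav_prob (i : 'I_m) (j : 'I_n) (a : nat) :
  favors j (prob i j) -> fav i j a.
Proof.
move=> fp; rewrite favE; apply/existsP; have [l el] := exists_prob i j.
by exists l; rewrite el fp price_prob.
Qed.

Lemma input_cofinal (i a : nat) : i < m -> exists p,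
  [/\ p < size (enc_instance I), inp p <= a &
     forall j, j < n -> fav i j a -> fav i j (inp p)].
Proof.
move=> im; have [n0|n0] := posnP n.
  exists 3; split; last by move=> j; rewrite n0.
    by rewrite size_enc_instance.
  by rewrite input_issues n0.
pose i' := Ordinal im; have [l0 el0] := exists_prob i' (Ordinal n0).
pose pr (c : 'I_n * 'I_k.+2) := price i' c.1 c.2.
have affordable0 : pr (Ordinal n0, l0) <= a by rewrite /pr price_prob.
have [[j l] pa pmax] := arg_maxnP pr (P := fun c => pr c <= a) affordable0.
pose p := 5 + n + (i * (1 + n * (3 + k.+2)) + (1 + (j * (3 + k.+2) + (3 + l)))).
have ep : inp p = price i' j l := price_atE i' j l.
exists p; split; [|by rewrite ep|].
- rewrite size_enc_instance ltn_add2l.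
  apply: (@leq_trans (i.+1 * (1 + n * (3 + k.+2)))); last first.
    by rewrite leq_mul2r im orbT.
  rewrite mulSn addnC ltn_add2r ltn_add2l.
  apply: (@leq_trans (j.+1 * (3 + k.+2))); last first.
    by rewrite leq_mul2r ltn_ord orbT.
  by rewrite mulSn addnC ltn_add2r ltn_add2l.
- move=> j' j'n; rewrite ep -[i]/(val i') -[j']/(val (Ordinal j'n)) !favE.
  move=> /existsP[l' /andP[pl' fl']]; apply/existsP; exists l'.
  by rewrite fl' andbT; exact: (pmax (Ordinal j'n, l') pl').
Qed.

Lemma wonE (Q : 'I_m -> 'I_n -> rat) (j : 'I_n) :
  won Q j = (m./2 < favor_count Q j).
Proof.
rewrite /won ltr_pdivrMr // -natrM ltr_nat.
by move: (favor_count Q j) => c; apply/idP/idP; lia.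
Qed.

Lemma favor_countE (Q : 'I_m -> 'I_n -> rat) (j : 'I_n) :
  favor_count Q j = \sum_(i < m) favors j (Q i j).
Proof. by rewrite /favor_count cardsE -sum1_card big_mkcond. Qed.

Lemma rem_strict_cover : rem m n fav (fun=> 0) <= strict_cover_number I.
Proof.
apply: leq_sum => j _; apply: leq_sub2l; rewrite favor_countE.
apply: leq_sum => i _; case fp: (favors j (prob i j)) => //.
by rewrite fav_prob.
Qed.

Section Bribery.
Variable R : realType.
Local Open Scope ring_scope.

Lemma favors_bribed (d : 'I_m -> R) (i : 'I_m) (j : 'I_n) : 0 <= d i ->
  favors j (bribed_prob d i j) =
  [exists l, ((price i j l)%:R <= d i / n%:R) && favors j (admissible l)].
Proof.
move=> d0; have [l0 el0] := exists_prob i j.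
have affordable0 : (price i j l0)%:R <= d i / n%:R.
  by rewrite price_prob // divr_ge0.
rewrite /bribed_prob /favors; case: (target j).
  apply/bigmax_gtP/existsP => [[tp|[l /andP[_ al] tl]]|[l /andP[al tl]]].
  - by exists l0; rewrite affordable0 el0.
  - by exists l; rewrite al.
  have [pl|lp] := leP (prob i j) (admissible l).
    by right; exists l; rewrite ?pl.
  by left; exact: lt_trans lp.
under eq_existsb => l do rewrite ltrBrDl -ltrBrDr.
rewrite ltrBrDl -ltrBrDr.
apply/bigmin_ltP/existsP => [[tp|[l /andP[_ al] tl]]|[l /andP[al tl]]].
- by exists l0; rewrite affordable0 el0.
- by exists l; rewrite al.
have [pl|lp] := leP (admissible l) (prob i j).
  by right; exists l; rewrite ?pl.
by left; exact: lt_trans tl.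
Qed.

Lemma favor_count_bribed (d : 'I_m -> R) (A : nat -> nat) (j : 'I_n) :
  (forall i, 0 <= d i) ->
  (forall (i : 'I_m) (c : nat), (c%:R <= d i / n%:R) = (c <= A i)%N) ->
  favor_count (bribed_prob d) j = cov m fav A j.
Proof.
move=> d0 dA; rewrite favor_countE; apply: eq_bigr => i _.
rewrite favors_bribed // favE; congr nat_of_bool.
by apply: eq_existsb => l; rewrite dA.
Qed.

Definition equal_split (A : nat -> nat) (i : 'I_m) : rat := (n * A i)%:R.

Lemma equal_split_winning (A : nat -> nat) :
  (forall j, (j < n)%N -> (m./2 < cov m fav A j)%N) ->
  winning_bribery (fun i => ratr (equal_split A i) : R).
Proof.
move=> win; have d0 i : 0 <= ratr (equal_split A i) :> R.
  by rewrite ler0q.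
split=> // j; rewrite wonE (favor_count_bribed _ A) ?win // => i c.
rewrite /equal_split ratr_nat natrM mulrAC divff ?mul1r ?ler_nat //.
by rewrite pnatr_eq0 -lt0n (leq_ltn_trans (leq0n _) (ltn_ord j)).
Qed.

Definition rounding (d : 'I_m -> R) (i : nat) : nat :=
  if insub i is Some i' then Num.trunc (d i' / n%:R) else 0%N.

Lemma rounding_winning (d : 'I_m -> R) (j : nat) :
  winning_bribery d -> (j < n)%N -> (m./2 < cov m fav (rounding d) j)%N.
Proof.
move=> [d0 win] jn; have := win (Ordinal jn); rewrite wonE.
rewrite (favor_count_bribed _ (rounding d)) // => i c.
by rewrite /rounding valK truncn_ge_nat ?divr_ge0.
Qed.

Lemma rounding_cost (d : 'I_m -> R) : winning_bribery d ->
  n%:R * (\sum_(i < m) rounding d i)%:R <= bribery_cost d.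
Proof.
move=> [d0 _]; rewrite natr_sum mulr_sumr; apply: ler_sum => i _.
rewrite /rounding valK; have [->|n0] := posnP n; first by rewrite mul0r.
have nR : 0 < n%:R :> R by rewrite ltr0n.
by rewrite mulrC -ler_pdivlMr // truncn_le divr_ge0.
Qed.

Lemma greedy_approx :
  let W := size (enc_instance I) in
  let A := iter W (greedy_step m n W fav inp) (fun=> 0%N) in
  (exists d : 'I_m -> R, winning_bribery d) ->
  let b := fun i => ratr (equal_split A i) : R in
  winning_bribery b /\
  bribery_cost b <= (ln (strict_cover_number I)%:R + 1) * min_cost I R.
Proof.
move=> W A [d0 win0] b.
have bound d : winning_bribery d -> rem m n fav A = 0%N /\
    (\sum_(i < m) A i)%:R <= (\sum_(i < m) rounding d i)%:R *
       potential R (rem m n fav (fun=> 0%N)).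
  move=> wd; have winB j := rounding_winning d j wd.
  have [rW cW] := greedy_cost m n W fav inp fav_mono input_cofinal R _ W winB.
  have r0 : rem m n fav A = 0%N.
    case: rW => // rW; apply/eqP; rewrite -leqn0 -(leq_add2r W) add0n.
    apply: leq_trans rW (leq_trans (rem_le _ _ _ _ _ winB) _).
    by rewrite /W size_enc_instance; nia.
  by split=> //; move: cW; rewrite -/A r0 subr0.
have [r0 _] := bound _ win0.
have winb : winning_bribery b.
  by apply: equal_split_winning => j; exact: rem0_win.
split=> //.
set N := strict_cover_number I.
have lnN : 0 < ln N%:R + 1 :> R.
  have [->|N0] := posnP N; first by rewrite ln0 ?add0r.
  by rewrite ltr_wpDl // ln_ge0 // ler1n.
rewrite mulrC -ler_pdivrMr //; apply: lb_le_inf.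
  by exists (bribery_cost d0), d0.
move=> _ [d /= wd <-]; rewrite ler_pdivrMr //.
have -> : bribery_cost b = n%:R * (\sum_(i < m) A i)%:R.
  rewrite natr_sum mulr_sumr; apply: eq_bigr => i _.
  by rewrite /b /equal_split ratr_nat natrM.
have [_ leA] := bound _ wd.
apply: le_trans (ler_wpM2l (ler0n _ _) leA) _; rewrite mulrA.
apply: le_trans (ler_wpM2r (ltW lnN) (rounding_cost _ wd)).
apply: ler_wpM2l; first by rewrite mulr_ge0.
exact: potential_le rem_strict_cover.
Qed.

End Bribery.
End Encoding.

(** * The program *)

Local Notation var v := (Get 2 (Const v)).
Local Notation Var v := (Cell 1 (Lit v)).
Local Notation In e := (Cell 0 e).
Local Notation Amount e := (Cell 2 e).

(* Variables 0, 1, 2 and 3 hold the number of issues, the number of voters, the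
   number of prices in a list, and the length of the input; variable 4 is the
   voter to be raised, 5 and 6 count rounds. Array 4 holds the amounts per
   issue. *)
Definition price_sexp (i j l : nat) : sexp :=
  In (Plus (Plus (Lit 5) (Var 0))
    (Plus (Times (Var i) (Plus (Lit 1) (Times (Var 0) (Plus (Lit 3) (Var 2)))))
       (Plus (Lit 1) (Plus (Times (Var j) (Plus (Lit 3) (Var 2)))
          (Plus (Lit 3) (Var l)))))).

Definition agenda_sexp (j l : nat) : sexp :=
  let goal := In (Plus (Lit 4) (Var j)) in
  let top := Plus (Lit 1) (In (Lit 0)) in
  let exceeds e :=
    Leq (Plus (Lit 1) (Times (In (Lit 1)) top)) (Times e (In (Lit 2))) in
  Plus (Times goal (exceeds (Var l)))
    (Times (Minus (Lit 1) goal) (exceeds (Minus top (Var l)))).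

Definition fav_sexp (i j : nat) (a : sexp) : sexp :=
  Leq (Lit 1) (Sum 6 2 (Times (Leq (price_sexp i j 6) a) (agenda_sexp j 6))).

Definition gain_sexp (i : nat) (a : sexp) : sexp :=
  Sum 8 0 (Times
    (Leq (Times (Lit 2) (Sum 7 1 (fav_sexp 7 8 (Amount (Var 7))))) (Var 1))
    (Times (fav_sexp i 8 a) (Leq (fav_sexp i 8 (Amount (Var i))) (Lit 0)))).

Definition best_sexp (i p : nat) : sexp :=
  Times (Leq (Lit 1) (gain_sexp i (In (Var p))))
    (Leq (Sum 9 1 (Sum 10 3
       (Leq (Plus (Lit 1) (Times (gain_sexp i (In (Var p)))
                             (Minus (In (Var 10)) (Amount (Var 9)))))
          (Times (gain_sexp 9 (In (Var 10)))
             (Minus (In (Var p)) (Amount (Var i))))))) (Lit 0)).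

Definition first_sexp (w : nat) (e : sexp) : sexp :=
  Sum 11 w (Leq (Sum 12 w (Times (Leq (Var 12) (Var 11)) e)) (Lit 0)).

Definition pick_voter_sexp : sexp := first_sexp 1 (Sum 13 3 (best_sexp 12 13)).

Definition pick_cand_sexp : sexp := first_sexp 3 (best_sexp 4 12).

Lemma sem_pick_voter (s : store) : sem s pick_voter_sexp =
  pick_voter (s 2 1) (s 2 0) (s 2 3) (fav_at (s 0) (s 2 0) (s 2 2)) (s 0) (s 4).
Proof. by []. Qed.

Lemma sem_pick_cand (s : store) : sem s pick_cand_sexp =
  pick_cand (s 2 1) (s 2 0) (s 2 3) (fav_at (s 0) (s 2 0) (s 2 2)) (s 0) (s 4)
    (s 2 4).
Proof. by []. Qed.

Definition length_expr : expr :=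
  Add (Add (Const 5) (var 0))
    (Mul (var 1) (Add (Const 1) (Mul (var 0) (Add (Const 3) (var 2))))).

Definition greedy_round : cmd :=
  comp pick_voter_sexp 0 ;;
  Assign 2 (Const 4) (stk 0) ;;
  comp pick_cand_sexp 0 ;;
  Assign 4 (var 4) (Get 0 (stk 0)) ;;
  Assign 2 (Const 5) (Add (var 5) (Const 1)).

Definition output_round : cmd :=
  Assign 1 (Add (Const 1) (Mul (var 6) (Const 2)))
    (Mul (var 0) (Get 4 (var 6))) ;;
  Assign 1 (Add (Const 2) (Mul (var 6) (Const 2))) (Const 1) ;;
  Assign 2 (Const 6) (Add (var 6) (Const 1)).

Definition lobby_program : cmd :=
  Assign 2 (Const 0) (Get 0 (Const 3)) ;;
  Assign 2 (Const 1) (Get 0 (Add (Const 4) (var 0))) ;;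
  Assign 2 (Const 2) (Get 0 (Add (Const 8) (var 0))) ;;
  Assign 2 (Const 3) length_expr ;;
  While (Sub (var 3) (var 5)) greedy_round ;;
  Assign 1 (Const 0) (var 1) ;;
  While (Sub (var 1) (var 6)) output_round.

Lemma runs_assign_seq (x : nat) (e1 e2 : expr) (c : cmd) (s : store)
    (Y B : nat) (Q : store -> Prop) :
  0 < Y -> reads_le s Y e1 -> reads_le s Y e2 ->
  runs c (update s x (eval s e1) (eval s e2)) B Q ->
  runs (Assign x e1 e2 ;; c) s (assign_cost Y e1 e2 + B) Q.
Proof.
move=> Y0 r1 r2 run.
apply: (runs_seq _ _ _ _ _ (eq (update s x (eval s e1) (eval s e2)))).
  exact: runs_assign.
by move=> _ <-.
Qed.

Lemma leq_exp2 (x S : nat) : x <= S -> x <= 2 ^ S.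
Proof. by move=> /leq_trans->//; rewrite ltnW // ltn_expl. Qed.

Lemma size_input_size (w : seq nat) : size w <= input_size w.
Proof.
by rewrite /input_size -sum1_size; apply: leq_sum => x _.
Qed.

Lemma nth_input_size (w : seq nat) (i : nat) : nth 0 w i <= 2 ^ input_size w.
Proof.
have [iw|wi] := ltnP i (size w); last by rewrite nth_default.
apply: leq_trans (leq_pow2_bitlen _) _; rewrite leq_exp2l //.
by rewrite /input_size (big_rem _ (mem_nth 0 iw)) leq_addr.
Qed.

Section Program.
Variable I : instance.
Local Notation m := (voters I).
Local Notation n := (issues I).
Local Notation K := (price_count I).
Local Notation W := (size (enc_instance I)).
Local Notation S := (input_size (enc_instance I)).
Local Notation step := (greedy_step m n W (fav I) (input I)).

Lemma input_size_gt0 : 0 < S.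
Proof.
by apply: leq_trans (size_input_size _); rewrite size_enc_instance.
Qed.

Lemma issues_le : n <= S.
Proof.
by apply: leq_trans (size_input_size _); rewrite size_enc_instance; nia.
Qed.

Lemma voters_le : m <= S.
Proof.
by apply: leq_trans (size_input_size _); rewrite size_enc_instance; nia.
Qed.

Lemma price_count_le : K <= S.
Proof.
apply: leq_trans (size_input_size _); rewrite size_input.
rewrite price_countE; case: ifP => // /andP[m0 n0].
apply: leq_trans (leq_addl _ _); rewrite -[X in X <= _]mul1n.
apply: leq_mul => //; apply: leq_trans (leq_addl 3 _) _.
by apply: leq_trans (leq_pmull _ n0) (leq_addl _ _).
Qed.

Record ready (A : nat -> nat) (t : nat) (s : store) : Prop := Ready {
  ready_input : forall i, s 0 i = input I i;
  ready_sizes : [/\ s 2 0 = n, s 2 1 = m, s 2 2 = K & s 2 3 = W];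
  ready_round : s 2 5 = t;
  ready_output : s 2 6 = 0;
  ready_amounts : forall i, s 4 i = A i;
  ready_bounded : bounded S s
}.

Lemma ready_agree (A : nat -> nat) (t r : nat) (s s' : store) :
  agree r s s' -> ready A t s -> ready A t s'.
Proof.
move=> a [inp [v0 v1 v2 v3] vt vo amt b]; split; rewrite ?a //.
- by move=> i; rewrite a.
- by move=> i; rewrite a.
- exact: bounded_agree _ _ _ _ a b.
Qed.

Lemma bounded_data (x i v : nat) (s : store) :
  x != 2 -> v <= 2 ^ S -> bounded S s -> bounded S (update s x i v).
Proof.
move=> x2 vS [b1 b2]; split=> [y j h|j]; rewrite /update.
  by case: andP => // _; exact: b1.
by rewrite eq_sym (negPf x2); exact: b2.
Qed.

End Program.

Lemma greedy_round_runs : exists2 f, polyfun f &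
  forall I A t s, t < size (enc_instance I) -> ready I A t s ->
    runs greedy_round s (f (input_size (enc_instance I)))
      (ready I (greedy_step (voters I) (issues I) (size (enc_instance I))
                  (fav I) (input I) A) t.+1).
Proof.
have [f1 pf1 run1] := comp_runs pick_voter_sexp 0.
have [f2 pf2 run2] := comp_runs pick_cand_sexp 0.
exists (fun S => f1 S + (assign_cost S (Const 4) (stk 0) + (f2 S +
   (assign_cost S (var 4) (Get 0 (stk 0)) +
    assign_cost S (Const 5) (Add (var 5) (Const 1)))))).
  by rewrite /assign_cost; solve_polyfun.
move=> I A t s tW rdy; set S := input_size _.
have S0 : 0 < S := input_size_gt0 I.
have WS : size (enc_instance I) <= S := size_input_size _.
set i := pick_voter (voters I) (issues I) (size (enc_instance I))
  (fav I) (input I) A.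
set p := pick_cand (voters I) (issues I) (size (enc_instance I))
  (fav I) (input I) A i.
have iS : i <= S by exact: leq_trans (first_le _ _) (voters_le I).
have pS : p <= S by exact: leq_trans (first_le _ _) WS.
apply: runs_seq (run1 _ _ S0 (ready_bounded _ _ _ _ rdy)) _ => s1 [a1 v1].
have v1i : s1 3 0 = i.
  case: rdy => inp [w0 w1 w2 w3] _ _ amt _.
  by rewrite v1 sem_pick_voter (funext inp) (funext amt) w0 w1 w2 w3.
have {rdy}rdy := ready_agree _ _ _ _ _ _ a1 rdy.
apply: (runs_assign_seq _ _ _ _ _ _ _ _ S0) => //=.
  by rewrite v1i leq_exp2.
rewrite v1i; set s2 := update s1 _ _ _.
have s2i : s2 2 4 = i by [].
have {v1 v1i rdy a1}rdy : ready I A t s2.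
  by case: rdy => *; split=> //; exact: bounded_var.
apply: runs_seq (run2 _ _ S0 (ready_bounded _ _ _ _ rdy)) _ => s3 [a3 v3].
have v3p : s3 3 0 = p.
  case: rdy => inp [w0 w1 w2 w3] _ _ amt _.
  by rewrite v3 sem_pick_cand (funext inp) (funext amt) w0 w1 w2 w3 s2i.
have s3i : s3 2 4 = i by rewrite a3.
have {v3 rdy a3}[inp [w0 w1 w2 w3] wt wo amt b] :=
  ready_agree _ _ _ _ _ _ a3 rdy.
have inpS q : input I q <= 2 ^ S by exact: nth_input_size.
apply: (runs_assign_seq _ _ _ _ _ _ _ _ S0).
- by rewrite /= s3i leq_exp2.
- by rewrite /= v3p inp; split; [exact: inpS|rewrite leq_exp2].
rewrite /= s3i v3p inp; apply: (runs_assign _ _ _ _ _ _ S0) => //=.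
  by rewrite /update /= wt leq_exp2 // ltnW // (leq_trans tW).
split=> //.
- by rewrite /update /= wt addn1.
- by move=> k; rewrite /update /= amt.
- apply: bounded_var; last exact: bounded_data.
  by rewrite /update /= wt addn1 (leq_trans tW).
Qed.

Record written (I : instance) (A : nat -> nat) (t : nat) (s : store) : Prop :=
  Written {
    written_sizes : s 2 0 = issues I /\ s 2 1 = voters I;
    written_index : s 2 6 = t;
    written_amounts : forall i, s 4 i = A i;
    written_head : s 1 0 = voters I;
    written_cells : forall i, i < t ->
      s 1 (1 + i * 2) = issues I * A i /\ s 1 (2 + i * 2) = 1
  }.

Lemma output_round_runs : exists2 f, polyfun f &
  forall I A t s, t < voters I ->
    (forall i, A i <= 2 ^ input_size (enc_instance I)) -> written I A t s ->
    runs output_round s (f (input_size (enc_instance I))) (written I A t.+1).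
Proof.
exists (fun S =>
  assign_cost S (Add (Const 1) (Mul (var 6) (Const 2)))
    (Mul (var 0) (Get 4 (var 6))) +
  (assign_cost S (Add (Const 2) (Mul (var 6) (Const 2))) (Const 1) +
   assign_cost S (Const 6) (Add (var 6) (Const 1)))).
  by rewrite /assign_cost; solve_polyfun.
move=> I A t s tm; set S := input_size _ => AS [[w0 w1] wt amt hd cells].
have S0 : 0 < S := input_size_gt0 I.
have tS : t <= 2 ^ S by rewrite leq_exp2 // ltnW // (leq_trans tm) ?voters_le.
have nS : issues I <= 2 ^ S by rewrite leq_exp2 ?issues_le.
apply: (runs_assign_seq _ _ _ _ _ _ _ _ S0); rewrite /= ?wt ?w0 ?amt //.
apply: (runs_assign_seq _ _ _ _ _ _ _ _ S0) => //=; rewrite /update /= ?wt //.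
apply: (runs_assign _ _ _ _ _ _ S0) => //=; rewrite ?wt //.
split=> //=; first by rewrite addn1.
have odd_even k l : (1 + k * 2 == 2 + l * 2) = false by apply/eqP; lia.
have even_odd k l : (2 + k * 2 == 1 + l * 2) = false by apply/eqP; lia.
move=> i; rewrite ltnS leq_eqVlt /update odd_even => /orP[/eqP->|it].
  by rewrite !eqxx.
have [c1 c2] := cells i it.
by rewrite even_odd !eqn_add2l !eqn_pmul2r // (ltn_eqF it).
Qed.

Lemma written_outputs (I : instance) (A : nat -> nat) (s : store) :
  written I A (voters I) s -> outputs s (enc_amounts (equal_split I A)).
Proof.
move=> [_ _ _ hd cells] [_|i]; first by rewrite hd /= size_enum_ord.
rewrite /enc_amounts /enc_list /= (size_ord_blocks _ 2) // ltnS => im.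
have i2 : i %/ 2 < voters I by rewrite ltn_divLR.
have [c1 c2] := cells _ i2.
rewrite {2}(divn_eq i 2) -[flatten _]cats0.
rewrite (nth_ord_blocks _ 2 _ _ (Ordinal i2)) ?ltn_mod //.
have -> : equal_split I A (Ordinal i2) =
  (issues I * A (i %/ 2))%N%:Z%:~R%R by [].
rewrite /enc_rat numq_int denq_int.
rewrite [in LHS](divn_eq i 2).
have := ltn_pmod i (ltn0Sn 1).
case: (i %% 2) => [|[|//]] _ /=; first by rewrite addn0 c1.
by rewrite addn1 c2.
Qed.

Lemma iter_step_le (I : instance) (W t i : nat) :
  iter t (greedy_step (voters I) (issues I) W (fav I) (input I)) (fun=> 0) i <=
  2 ^ input_size (enc_instance I).
Proof.
elim: t => [//|t IH] /=; rewrite {1}/greedy_step; case: ifP => // _.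
exact: nth_input_size.
Qed.

Lemma lobby_program_runs : exists2 f, polyfun f & forall I : instance,
  runs lobby_program (input_store (enc_instance I))
    (f (input_size (enc_instance I)))
    (written I (iter (size (enc_instance I))
       (greedy_step (voters I) (issues I) (size (enc_instance I))
          (fav I) (input I)) (fun=> 0)) (voters I)).
Proof.
have [f1 pf1 run1] := greedy_round_runs.
have [f2 pf2 run2] := output_round_runs.
exists (fun S => assign_cost S (Const 0) (Get 0 (Const 3)) +
  (assign_cost S (Const 1) (Get 0 (Add (Const 4) (var 0))) +
  (assign_cost S (Const 2) (Get 0 (Add (Const 8) (var 0))) +
  (assign_cost S (Const 3) length_expr +
  (S * (S * (esize (Sub (var 3) (var 5))).+1 ^ 2 + f1 S) +
   S * (esize (Sub (var 3) (var 5))).+1 ^ 2 +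
  (assign_cost S (Const 0) (var 1) +
  (S * (S * (esize (Sub (var 1) (var 6))).+1 ^ 2 + f2 S) +
   S * (esize (Sub (var 1) (var 6))).+1 ^ 2))))))).
  by rewrite /assign_cost; solve_polyfun.
move=> I; set S := input_size _; set W := size _.
set step := greedy_step _ _ _ _ _.
have S0 : 0 < S := input_size_gt0 I.
have WS : W <= S := size_input_size _.
have nS := issues_le I; have mS := voters_le I; have KS := price_count_le I.
rewrite -/S in nS mS KS.
have inpS q : input I q <= 2 ^ S by exact: nth_input_size.
set s0 := input_store _.
have s0E i : s0 0 i = input I i by [].
apply: (runs_assign_seq _ _ _ _ _ _ _ _ S0) => //.
  by rewrite /= s0E inpS.
rewrite [eval _ (Get _ _)]s0E input_issues.
apply: (runs_assign_seq _ _ _ _ _ _ _ _ S0) => //.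
  by split; [exact: inpS|do !split; apply: leq_exp2].
rewrite [eval _ (Get _ _)](_ : _ = voters I); last exact: input_voters.
apply: (runs_assign_seq _ _ _ _ _ _ _ _ S0) => //.
  by split; [exact: inpS|do !split; apply: leq_exp2].
rewrite [eval _ (Get _ _)](_ : _ = price_count I); last by [].
apply: (runs_assign_seq _ _ _ _ _ _ _ _ S0) => //.
  by do !split; apply: leq_exp2.
rewrite [eval _ length_expr](_ : _ = W); last by rewrite /W size_input.
set s4 := update _ _ _ W.
have rdy0 : ready I (fun=> 0) 0 s4.
  split=> //; do 4! apply: bounded_var => //; split=> [x i _|//].
  by rewrite /s0 /input_store; case: ifP => // _; exact: nth_input_size.
apply: (runs_seq _ _ _ _ _ (ready I (iter W step (fun=> 0)) W)).
  apply: (runs_weaken _ _ (W * (S * (esize (Sub (var 3) (var 5))).+1 ^ 2 + f1 S)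
    + S * (esize (Sub (var 3) (var 5))).+1 ^ 2) _
    (ready I (iter W step (fun=> 0)) W)) => //.
    by rewrite leq_add2r leq_mul2r WS orbT.
  apply: (runs_while _ _ _ _ _
    (fun t => ready I (iter t step (fun=> 0)) t)) rdy0.
    move=> t s tW rdy; split; last exact: run1.
      by case: rdy => _ [_ _ _ w3] wt _ _ _; rewrite /= w3 wt -/W; lia.
    apply: ecost_le => //; case: rdy => _ [_ _ _ w3] wt _ _ _.
    by rewrite /= w3 wt !leq_exp2 // ltnW // (leq_trans tW).
  move=> s [_ [_ _ _ w3] wt _ _ _]; split; first by rewrite /= w3 wt subnn.
  by apply: ecost_le => //=; rewrite w3 wt !leq_exp2.
move=> s [_ [w0 w1 _ _] _ wo amt _].
apply: (runs_assign_seq _ _ _ _ _ _ _ _ S0) => //.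
  by rewrite /= w1 leq_exp2.
rewrite [eval _ (Get _ _)]w1.
set A := iter _ _ _ in amt *.
have AS i : A i <= 2 ^ S by exact: iter_step_le.
apply: (runs_weaken _ _
    (voters I * (S * (esize (Sub (var 1) (var 6))).+1 ^ 2 + f2 S) + S * (esize (Sub (var 1) (var 6))).+1 ^ 2) _ (written I A (voters I))) => //.
  by rewrite leq_add2r leq_mul2r mS orbT.
apply: (runs_while _ _ _ _ _ (written I A)).
- move=> t s' tm wr; split; last exact: run2.
    by case: wr => [[_ v1] vt _ _ _]; rewrite /= v1 vt; lia.
  apply: ecost_le => //; case: wr => [[_ v1] vt _ _ _].
  by rewrite /= v1 vt !leq_exp2 // ltnW // (leq_trans tm).
- move=> s' [[_ v1] vt _ _ _]; split; first by rewrite /= v1 vt subnn.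
  by apply: ecost_le => //=; rewrite v1 vt !leq_exp2.
- by split.
Qed.

Local Open Scope ring_scope.

Theorem theorem6p5 (R : realType) :
  exists (c : cmd) (q : {poly nat}), forall I : instance,
    exists (T : nat) (s : store),
      [/\ exec c (input_store (enc_instance I)) T s,
          (T <= q.[input_size (enc_instance I)])%N &
          (exists d : 'I_(voters I) -> R, winning_bribery d) ->
          exists b : 'I_(voters I) -> rat,
            let d := fun i => ratr (b i) : R in
            [/\ outputs s (enc_amounts b),
                winning_bribery d &
                bribery_cost d <=
                  (ln (strict_cover_number I)%:R + 1) * min_cost I R]].
Proof.
have [f [q fq] run] := lobby_program_runs.
exists lobby_program, q => I; have [T [s [ex Tf wr]]] := run I.
exists T, s; split; [exact: ex|by rewrite -fq|move=> win].
have [winb costb] := greedy_approx I R win.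
eexists; split; [exact: written_outputs wr|exact: winb|exact: costb].
Qed.
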